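(* Let $\mathbb{K}$ be a field of characteristic zero, $A$ a finite-dimensional pre-Malcev algebra over $\mathbb{K}$, and $V$ a finite-dimensional $A$-bimodule. Let $T:V\to A$ be a Kupershmidt operator on $A_V$ and let $N:A\to A$ be a Nijenhuis operator on $A$. Then $NT$ is a Kupershmidt operator on $A_V$ if and only if $$N\left(NT(u)\,T(v)+T(u)\,NT(v)\right)=N\left(T(\ell_{NT(u)}(v)+r_{NT(v)}(u))+NT(\ell_{T(u)}(v)+r_{T(v)}(u))\right)$$ for all $u,v\in V$. In this case, if $N$ is invertible, then $T$ and $NT$ are compatible.
   Context: A pre-Malcev algebra over $\mathbb{K}$ is a nonassociative algebra $A$ over $\mathbb{K}$ such that for all $x,y,z,t\in A$: $(yz-zy)(xt)+((xy-yx)z-z(xy-yx))t+y((xz-zx)t)-x(y(zt))+z(x(yt))=0$. An $A$-bimodule is a vector space $V$ with linear maps $\ell,r:A\to\mathfrak{gl}(V)$, $x\mapsto\ell_x$, $x\mapsto r_x$, such that for all $x,y,z\in A$: (i) $r_x r_y r_z-r_x r_y\ell_z-r_x\ell_y r_z+r_x\ell_y\ell_z-r_{z(yx)}+\ell_y r_{zx}+\ell_{zy}r_x-\ell_{yz}r_x-\ell_z r_x\ell_y+\ell_z r_x r_y=0$; (ii) $r_{x}r_{y}\ell_{z}-r_{x}r_{y}r_{z}-r_{x}\ell_{y}\ell_{z}+r_{x}\ell_{y}r_{z}-\ell_{z}r_{yx}+\ell_{y}\ell_{z}r_{x}+r_{zx}r_{y}-r_{zx}\ell_{y}-r_{(yz)x}+r_{(zy)x}=0$;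 (iii) $r_{x}\ell_{yz}-r_{x}\ell_{zy}-r_{x}r_{yz}+r_{x}r_{zy}-\ell_{y}\ell_{z}r_{x}+r_{y(zx)}+r_{yx}\ell_{z}-r_{yx}r_{z}-\ell_{z}r_{x}r_{y}+\ell_{z}r_{x}\ell_{y}=0$; (iv) $\ell_{(xy)z}-\ell_{(yx)z}-\ell_{z(xy)}+\ell_{z(yx)}-\ell_{x}\ell_{y}\ell_{z}+\ell_{z}\ell_{x}\ell_{y}+\ell_{yz}\ell_{x}-\ell_{zy}\ell_{x}-\ell_{y}\ell_{zx}+\ell_{y}\ell_{xz}=0$. $A_V$ denotes the action of $A$ on $V$ given by $\ell,r$. A Kupershmidt operator on $A_V$ is a linear map $T:V\to A$ with $T(u)T(v)=T(\ell_{T(u)}(v)+r_{T(v)}(u))$ for all $u,v\in V$. Two Kupershmidt operators $T_1,T_2$ on $A_V$ are compatible if $T_1+T_2$ is a Kupershmidt operator on $A_V$. A Nijenhuis operator on $A$ is a linear map $N:A\to A$ with $N(x)N(y)=N(N(x)y+xN(y)-N(xy))$ for all $x,y\in A$. *)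

(* Defs.v *)
From mathcomp Require Import all_boot all_algebra.
Set Implicit Arguments.
Unset Strict Implicit.
Unset Printing Implicit Defensive.
Import GRing.Theory.
Local Open Scope ring_scope.

Reserved Notation "x ∙ y" (at level 40, left associativity).

Section PreMalcevIdentity.
Variables (K : fieldType) (A : vectType K) (mul : A -> A -> A).
Local Notation "x ∙ y" := (mul x y).

Definition pre_malcev_identity : Prop := forall x y z t : A,
  (y ∙ z - z ∙ y) ∙ (x ∙ t)
  + ((x ∙ y - y ∙ x) ∙ z - z ∙ (x ∙ y - y ∙ x)) ∙ t
  + y ∙ ((x ∙ z - z ∙ x) ∙ t)
  - x ∙ (y ∙ (z ∙ t)) + z ∙ (x ∙ (y ∙ t)) = 0.

End PreMalcevIdentity.

Record preMalcevAlgebra (K : fieldType) : Type := PreMalcevAlgebra {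
  pm_space :> vectType K;
  pm_mul : {bilinear pm_space -> pm_space -> pm_space};
  pm_mulP : pre_malcev_identity pm_mul
}.

Notation "x ∙ y" := (pm_mul _ x y) : ring_scope.

Section BimoduleIdentities.
Variables (K : fieldType) (A : preMalcevAlgebra K) (V : vectType K).
Variables (l r : 'Hom(A, 'End(V))).
(* Composition, (f ∘ g) v = f (g v); unlike [\o], it binds tighter than [+]. *)
Local Notation "f ∘ g" := (comp_lfun f g) (at level 40, left associativity).

(* [pre_malcev_identity] on the split null extension A (+) V, where
   l a v = a v and r a v = v a, with the vector of V put in turn in each of
   the four argument places. *)
Definition bimodule_identity1 : Prop := forall x y z : A,
  r x ∘ r y ∘ r z - r x ∘ r y ∘ l z - r x ∘ l y ∘ r z + r x ∘ l y ∘ l z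
  - r (z ∙ (y ∙ x)) + l y ∘ r (z ∙ x) + l (z ∙ y) ∘ r x - l (y ∙ z) ∘ r x
  - l z ∘ r x ∘ l y + l z ∘ r x ∘ r y = 0.

Definition bimodule_identity2 : Prop := forall x y z : A,
  r x ∘ r y ∘ l z - r x ∘ r y ∘ r z - r x ∘ l y ∘ l z + r x ∘ l y ∘ r z
  - l z ∘ r (y ∙ x) + l y ∘ l z ∘ r x + r (z ∙ x) ∘ r y - r (z ∙ x) ∘ l y
  - r ((y ∙ z) ∙ x) + r ((z ∙ y) ∙ x) = 0.

Definition bimodule_identity3 : Prop := forall x y z : A,
  r x ∘ l (y ∙ z) - r x ∘ l (z ∙ y) - r x ∘ r (y ∙ z) + r x ∘ r (z ∙ y)
  - l y ∘ l z ∘ r x + r (y ∙ (z ∙ x)) + r (y ∙ x) ∘ l z - r (y ∙ x) ∘ r z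
  - l z ∘ r x ∘ r y + l z ∘ r x ∘ l y = 0.

Definition bimodule_identity4 : Prop := forall x y z : A,
  l ((x ∙ y) ∙ z) - l ((y ∙ x) ∙ z) - l (z ∙ (x ∙ y)) + l (z ∙ (y ∙ x))
  - l x ∘ l y ∘ l z + l z ∘ l x ∘ l y + l (y ∙ z) ∘ l x - l (z ∙ y) ∘ l x
  - l y ∘ l (z ∙ x) + l y ∘ l (x ∙ z) = 0.

End BimoduleIdentities.

Record bimodule (K : fieldType) (A : preMalcevAlgebra K) : Type := Bimodule {
  bim_space :> vectType K;
  lact : 'Hom(A, 'End(bim_space));
  ract : 'Hom(A, 'End(bim_space));
  bim_identity1 : bimodule_identity1 lact ract;
  bim_identity2 : bimodule_identity2 lact ract;
  bim_identity3 : bimodule_identity3 lact ract;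
  bim_identity4 : bimodule_identity4 lact
}.

Notation "\ell_ x" := (lact _ x) (at level 8, x at level 2, format "\ell_ x") :
  ring_scope.
Notation "\r_ x" := (ract _ x) (at level 8, x at level 2, format "\r_ x") :
  ring_scope.

Section Operators.
Variables (K : fieldType) (A : preMalcevAlgebra K) (V : bimodule A).

Definition kupershmidt (T : 'Hom(V, A)) : Prop := forall u v : V,
  T u ∙ T v = T (\ell_(T u) v + \r_(T v) u).

Definition compatible (T1 T2 : 'Hom(V, A)) : Prop :=
  [/\ kupershmidt T1, kupershmidt T2 & kupershmidt (T1 + T2)].

Definition nijenhuis (N : 'End(A)) : Prop := forall x y : A,
  N x ∙ N y = N (N x ∙ y + x ∙ N y - N (x ∙ y)).

End Operators.

(* Main.v *)
Require Import Defs.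
From mathcomp Require Import all_boot all_algebra.
Import GRing.Theory.
Local Open Scope ring_scope.

(** Put [a = T(\ell_(T u) v + \r_(T v) u)] and [b = T(\ell_(N (T u)) v + \r_(N (T v)) u)]. Since
    [T u ∙ T v = a], the Nijenhuis identity turns [N (T u) ∙ N (T v)] into [N(mixed) - N (N a)],
    where [mixed] is [N (T u) ∙ T v + T u ∙ N (T v)]. Hence [N T] is Kupershmidt, i.e. this equals
    [N b], exactly when [N(mixed) = N(b + N a)]. If [N] is injective, then [mixed = b + N a], which
    is what the cross terms for [T + N T] require. *)

Theorem proposition3p2 (K : fieldType) (charK : [pchar K] =i pred0)
    (A : preMalcevAlgebra K) (V : bimodule A) (T : 'Hom(V, A)) (N : 'End(A)) :
  kupershmidt T -> nijenhuis N ->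
  (kupershmidt (N \o T)%VF <->
     forall u v : V,
       N (N (T u) ∙ T v + T u ∙ N (T v)) =
       N (T (\ell_(N (T u)) v + \r_(N (T v)) u)
          + N (T (\ell_(T u) v + \r_(T v) u))))
  /\ (kupershmidt (N \o T)%VF -> bijective N -> compatible T (N \o T)%VF).
Proof.
move=> kupT nijN; split.
  suff kupNT_E u v :
      N (T u) ∙ N (T v) = N (T (\ell_(N (T u)) v + \r_(N (T v)) u)) <->
      N (N (T u) ∙ T v + T u ∙ N (T v)) =
      N (T (\ell_(N (T u)) v + \r_(N (T v)) u)
         + N (T (\ell_(T u) v + \r_(T v) u))).
    split=> H u v; first by apply/kupNT_E; move: (H u v); rewrite !comp_lfunE.
    by rewrite !comp_lfunE; apply/kupNT_E.
  (* Both equations now differ only by moving [N (N a)] across the equality. *)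
  rewrite nijN kupT linearB [N (T _ + _)]linearD /=.
  by split=> [<-|->]; rewrite ?subrK ?addrK.
move=> kupNT bijN; split=> // u v.
have cross : N (T u) ∙ T v + T u ∙ N (T v) =
    T (\ell_(N (T u)) v + \r_(N (T v)) u)
    + N (T (\ell_(T u) v + \r_(T v) u)).
  (* Injectivity strips the outer [N] from the criterion. *)
  apply: (bij_inj bijN); move: (kupNT u v).
  by rewrite !comp_lfunE nijN kupT linearB [N (T _ + _)]linearD /= => <-; rewrite subrK.
have actE : \ell_(T u + N (T u)) v + \r_(T v + N (T v)) u =
    (\ell_(T u) v + \r_(T v) u) + (\ell_(N (T u)) v + \r_(N (T v)) u).
  by rewrite !linearD /= !add_lfunE addrACA.
rewrite !add_lfunE !comp_lfunE actE !linearDl !linearDr /=.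
move: (kupNT u v); rewrite !comp_lfunE kupT => ->.
rewrite [T (_ + _ + (_ + _))]linearD /=; move: cross.
(* The right side is [a + b + N a + N b]: the pure products give [a] and [N b], and [cross] supplies
   [b + N a]. *)
set a := T (\ell_(T u) v + _); set b := T (_ + _).
move=> cross; rewrite linearD /= [LHS]addrA -(addrA a).
by rewrite [_ ∙ _ + _ ∙ _]addrC cross !addrA.
Qed.
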